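(* Diff-MPC is equivalent to using a Gauss-Newton approximation when solving the linear system $\mathcal{L}_{\boldsymbol{z}\boldsymbol{z}}\,\delta\boldsymbol{z}=-\nabla_{\boldsymbol{z}}L$.
   Context: The parameterized optimal control problem is, for $\theta\in\mathbb{R}^{n_\theta}$ and horizon $N\in\mathbb{N}$, $$\boldsymbol{\tau}^*(\theta)=\arg\min_{\boldsymbol{\tau}}\ \sum_{k=0}^{N-1}\ell(x_k,u_k,\theta)+\phi(x_N,\theta)\quad\text{subject to } x_{k+1}=f(x_k,u_k,\theta),\quad x_0=\xi(\theta),$$ where $\boldsymbol{\tau}=(x_0,u_0,x_1,u_1,\dots,x_N)$ with $x_k\in\mathbb{R}^{n_x}$, $u_k\in\mathbb{R}^{n_u}$; $\xi:\mathbb{R}^{n_\theta}\to\mathbb{R}^{n_x}$ is differentiable; $f$ ($\mathbb{R}^{n_x}$-valued) is the parameterized dynamics; and $\ell,\phi$ (real-valued) are the running and terminal costs. The Lagrangian is $$\mathcal{L}(\boldsymbol{z},\theta)=\sum_{k=0}^{N-1}\Big(\ell(x_k,u_k,\theta)+\lambda_{k+1}^\top\big(f(x_k,u_k,\theta)-x_{k+1}\big)\Big)+\lambda_0^\top(\xi(\theta)-x_0)+\phi(x_N,\theta),$$ with multipliers $\lambda_k\in\mathbb{R}^{n_x}$, $k=0,\dots,N$, and $\boldsymbol{z}=(\boldsymbol{\tau},\boldsymbol{\lambda})=(\lambda_0,x_0,u_0,\dots,\lambda_N,x_N)$; $\mathcal{L}_{\boldsymbol{z}\boldsymbol{z}}$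 is its Hessian in $\boldsymbol{z}$ and $\mathcal{L}_{\theta\boldsymbol{z}}$ its matrix of mixed second partial derivatives. All derivatives are evaluated along $\boldsymbol{z}^*=(\boldsymbol{\tau}^*,\boldsymbol{\lambda}^* )$, a solution together with multipliers satisfying $\nabla_{\boldsymbol{z}}\mathcal{L}(\boldsymbol{z}^*,\theta)=0$. $L$ is a differentiable loss function of the trajectory (so the $\lambda$-blocks of $\nabla_{\boldsymbol{z}}L$ are zero), and the solution $\delta\boldsymbol{z}$ of $\mathcal{L}_{\boldsymbol{z}\boldsymbol{z}}\delta\boldsymbol{z}=-\nabla_{\boldsymbol{z}}L$ is used to compute the gradient $\nabla_\theta L(\boldsymbol{z}^*(\theta))=\mathcal{L}_{\theta\boldsymbol{z}}\,\delta\boldsymbol{z}$. Gauss-Newton approximation: the blocks of $\mathcal{L}_{\boldsymbol{z}\boldsymbol{z}}$ for $x_k,u_k$ ($k=0,\dots,N-1$) are $\mathcal{L}^{(k)}_{ab}=\ell^{(k)}_{ab}+\lambda_{k+1}\otimes f^{(k)}_{ab}$, $a,b\in\{x,u\}$, where $\ell^{(k)}_{ab},f^{(k)}_{ab}$ are second derivatives at time $k$ and $\otimes$ is tensor contraction; the Gauss-Newton approximation of the Hessian drops the second term $\lambda_{k+1}\otimes f^{(k)}_{ab}$ of each. Diff-MPC (differentiable model predictive control, Amos et al.) is a method for differentiating through a model predictive controller, originally derived by starting from the iterative linear-quadratic regulator and implicitly differentiating with respect to its parameters. In the present notation its equations are given by solving $K\,\delta\boldsymbol{z}=-\nabla_{\boldsymbol{z}}L$,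 where the KKT matrix $K$ is the symmetric block matrix indexed by $(\lambda_0,x_0,u_0,\dots,\lambda_N,x_N)$ whose only nonzero blocks (up to transposition) are $K_{\lambda_k,x_k}=-I$ for $k=0,\dots,N$; $K_{x_k,x_k}=\ell^{(k)}_{xx}$, $K_{x_k,u_k}=\ell^{(k)}_{xu}$, $K_{u_k,u_k}=\ell^{(k)}_{uu}$, $K_{\lambda_{k+1},x_k}=f_{x_k}$, $K_{\lambda_{k+1},u_k}=f_{u_k}$ for $k=0,\dots,N-1$, with $f_{x_k},f_{u_k}$ the Jacobians of $f$ in $x,u$ at time $k$; and $K_{x_N,x_N}=\phi_{xx}$. *)

(* Defs.v *)
From HB Require Import structures.
From mathcomp Require Import all_boot all_order all_algebra.
From mathcomp Require Import boolp classical_sets reals topology normedtype derive.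

Set Implicit Arguments.
Unset Strict Implicit.
Unset Printing Implicit Defensive.

Import Order.TTheory GRing.Theory Num.Theory.
Import numFieldNormedType.Exports.

Local Open Scope classical_set_scope.
Local Open Scope ring_scope.

(* MathComp-Analysis over an arbitrary [R : realType]; vectors are columns. *)

Section Calculus.
Context {R : realType}.

Definition dot n (u v : 'cV[R]_n) : R := (u^T *m v) 0 0.

Definition partial n (g : 'cV[R]_n -> R) (j : 'I_n) (x : 'cV[R]_n) : R :=
  'D_(delta_mx j 0) g x.

Definition grad n (g : 'cV[R]_n -> R) (x : 'cV[R]_n) : 'cV[R]_n :=
  \col_j partial g j x.

(* The library's [jacobian] acts on row vectors; this is the usual m x n matrix
   for column vectors. *)
Definition jac m n (g : 'cV[R]_n -> 'cV[R]_m) (x : 'cV[R]_n) : 'M[R]_(m, n) :=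
  \matrix_(i, j) partial (fun y => g y i 0) j x.

Definition hess n (g : 'cV[R]_n -> R) (x : 'cV[R]_n) : 'M[R]_n :=
  \matrix_(i, j) partial (partial g i) j x.

(* Entry (i, j) is the derivative in b_j of the derivative in a_i of h. *)
Definition mixed_hess m n (h : 'cV[R]_m -> 'cV[R]_n -> R)
    (a : 'cV[R]_m) (b : 'cV[R]_n) : 'M[R]_(m, n) :=
  \matrix_(i, j) partial (fun b' => partial (h^~ b') i a) j b.

(* For finite-dimensional V, the second conjunct says that q |-> 'd h q is
   differentiable at p. *)
Definition twice_differentiable (V W : normedModType R) (h : V -> W) (p : V) :=
  (\forall q \near p, differentiable h q) /\
  (forall v, differentiable (fun q => 'D_v h q) p).

End Calculus.

Record ocp (R : realType) (nx nu nt : nat) := Ocp {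
  dynamics : 'cV[R]_nx -> 'cV[R]_nu -> 'cV[R]_nt -> 'cV[R]_nx;
  running_cost : 'cV[R]_nx -> 'cV[R]_nu -> 'cV[R]_nt -> R;
  terminal_cost : 'cV[R]_nx -> 'cV[R]_nt -> R;
  initial_state : 'cV[R]_nt -> 'cV[R]_nx
}.

(* The times t and t + 1 in {0, ..., N}, for a stage t in {0, ..., N - 1}. *)
Definition now N (t : 'I_N) : 'I_N.+1 := lift ord_max t.
Definition next N (t : 'I_N) : 'I_N.+1 := lift ord0 t.

(* The scalar coordinates of z: component i of lambda_k, of x_k (k <= N), and of
   u_k (k < N). *)
Variant zvar (N nx nu : nat) :=
  | Lam of 'I_N.+1 & 'I_nx
  | Sta of 'I_N.+1 & 'I_nx
  | Inp of 'I_N & 'I_nu.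
Arguments Lam {N nx nu}.
Arguments Sta {N nx nu}.
Arguments Inp {N nx nu}.

Section ZvarFinite.
Variables N nx nu : nat.

(* Stages (lambda_k, x_k, u_k) for k < N, then (lambda_N, x_N): the enumeration
   inherited from this sum follows the block order
   lambda_0, x_0, u_0, ..., lambda_N, x_N. *)
Definition zcode : Type :=
  ('I_N * (('I_nx + 'I_nx) + 'I_nu) + ('I_nx + 'I_nx))%type.

Definition zvar_code (v : zvar N nx nu) : zcode :=
  match v with
  | Lam k i => if unlift ord_max k is Some t then inl (t, inl (inl i))
               else inr (inl i)
  | Sta k i => if unlift ord_max k is Some t then inl (t, inl (inr i))
               else inr (inr i)
  | Inp t i => inl (t, inr i)
  end.

Definition zvar_decode (c : zcode) : zvar N nx nu :=
  match c with
  | inl (t, inl (inl i)) => Lam (now t) i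
  | inl (t, inl (inr i)) => Sta (now t) i
  | inl (t, inr i) => Inp t i
  | inr (inl i) => Lam ord_max i
  | inr (inr i) => Sta ord_max i
  end.

Lemma zvar_codeK : cancel zvar_code zvar_decode.
Proof.
by case=> [k i|k i|t i] //=; case: unliftP => [t|] -> //.
Qed.

HB.instance Definition _ := Finite.copy (zvar N nx nu) (can_type zvar_codeK).

End ZvarFinite.

Section DiffMPC.
Context {R : realType} {nx nu nt N : nat}.
Implicit Types (P : ocp R nx nu nt) (th : 'cV[R]_nt).

(* (X, U) with x_k = col k X and u_k = col k U. *)
Definition trajectory : Type := ('M[R]_(nx, N.+1) * 'M[R]_(nu, N))%type.

Definition zspace : Type := 'cV[R]_#|{: zvar N nx nu}|.

Definition zcoord (z : zspace) (v : zvar N nx nu) : R := z (enum_rank v) 0.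

Definition zmult (z : zspace) (k : 'I_N.+1) : 'cV[R]_nx :=
  \col_i zcoord z (Lam k i).

Definition ztraj (z : zspace) : 'M[R]_(nx, N.+1) * 'M[R]_(nu, N) :=
  (\matrix_(i, k) zcoord z (Sta k i), \matrix_(i, t) zcoord z (Inp t i)).

Definition zstate (z : zspace) (k : 'I_N.+1) : 'cV[R]_nx := col k (ztraj z).1.
Definition zinput (z : zspace) (t : 'I_N) : 'cV[R]_nu := col t (ztraj z).2.

Definition feasible P th (tau : trajectory) : Prop :=
  col ord0 tau.1 = initial_state P th /\
  forall t : 'I_N,
    col (next t) tau.1 = dynamics P (col (now t) tau.1) (col t tau.2) th.

Definition total_cost P th (tau : trajectory) : R :=
  \sum_(t < N) running_cost P (col (now t) tau.1) (col t tau.2) th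
  + terminal_cost P (col ord_max tau.1) th.

Definition optimal P th (tau : trajectory) : Prop :=
  feasible P th tau /\
  forall tau', feasible P th tau' -> total_cost P th tau <= total_cost P th tau'.

Definition lagrangian P th (z : zspace) : R :=
  \sum_(t < N)
     (running_cost P (zstate z (now t)) (zinput z t) th
      + dot (zmult z (next t))
            (dynamics P (zstate z (now t)) (zinput z t) th - zstate z (next t)))
  + dot (zmult z ord0) (initial_state P th - zstate z ord0)
  + terminal_cost P (zstate z ord_max) th.

Definition zmatrix (E : zvar N nx nu -> zvar N nx nu -> R) :
    'M[R]_#|{: zvar N nx nu}| :=
  \matrix_(p, q) E (enum_val p) (enum_val q).

Section Blocks.
Variables (P : ocp R nx nu nt) (th : 'cV[R]_nt) (z : zspace).

Let xk (t : 'I_N) := zstate z (now t).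
Let uk (t : 'I_N) := zinput z t.
Let f x u := dynamics P x u th.
Let l x u := running_cost P x u th.

Definition f_x (t : 'I_N) : 'M[R]_nx := jac (f^~ (uk t)) (xk t).
Definition f_u (t : 'I_N) : 'M[R]_(nx, nu) := jac (f (xk t)) (uk t).

Definition l_xx (t : 'I_N) : 'M[R]_nx := hess (l^~ (uk t)) (xk t).
Definition l_xu (t : 'I_N) : 'M[R]_(nx, nu) := mixed_hess l (xk t) (uk t).
Definition l_uu (t : 'I_N) : 'M[R]_nu := hess (l (xk t)) (uk t).

Definition phi_xx : 'M[R]_nx :=
  hess (terminal_cost P ^~ th) (zstate z ord_max).

(* The contractions of lambda_{t+1} with the second derivatives of f. *)
Definition lam_f_xx (t : 'I_N) : 'M[R]_nx :=
  \sum_m zmult z (next t) m 0 *: hess (fun x => f x (uk t) m 0) (xk t).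
Definition lam_f_xu (t : 'I_N) : 'M[R]_(nx, nu) :=
  \sum_m zmult z (next t) m 0 *: mixed_hess (fun x u => f x u m 0) (xk t) (uk t).
Definition lam_f_ux (t : 'I_N) : 'M[R]_(nu, nx) :=
  \sum_m zmult z (next t) m 0 *: mixed_hess (fun u x => f x u m 0) (uk t) (xk t).
Definition lam_f_uu (t : 'I_N) : 'M[R]_nu :=
  \sum_m zmult z (next t) m 0 *: hess (fun u => f (xk t) u m 0) (uk t).

(* The terms lambda_{k+1} (x) f_ab^(k), placed at the (x_k, x_k), (x_k, u_k),
   (u_k, x_k) and (u_k, u_k) blocks for k < N. *)
Definition curvature_entry (p q : zvar N nx nu) : R :=
  match p, q with
  | Sta k i, Sta k' j =>
      if (k == k', unlift ord_max k) is (true, Some t) then lam_f_xx t i j else 0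
  | Sta k i, Inp t j => if k == now t then lam_f_xu t i j else 0
  | Inp t i, Sta k j => if k == now t then lam_f_ux t i j else 0
  | Inp t i, Inp t' j => if t == t' then lam_f_uu t i j else 0
  | _, _ => 0
  end.

(* The Hessian of the Lagrangian in z, built from actual second partial
   derivatives, from which the terms lambda_{k+1} (x) f_ab^(k) are dropped. *)
Definition gauss_newton_hessian : 'M[R]_#|{: zvar N nx nu}| :=
  hess (lagrangian P th) z - zmatrix curvature_entry.

(* For k = t + 1 (the case [unlift ord0 k = Some t]) the block at (k, t) is f_x;
   in [K_x_x], [unlift ord_max k = Some t] means k = t < N. *)
Definition K_lam_x (k k' : 'I_N.+1) : 'M[R]_nx :=
  if k == k' then - 1%:M
  else if unlift ord0 k is Some t then (if k' == now t then f_x t else 0)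
  else 0.

Definition K_lam_u (k : 'I_N.+1) (t : 'I_N) : 'M[R]_(nx, nu) :=
  if k == next t then f_u t else 0.

Definition K_x_x (k k' : 'I_N.+1) : 'M[R]_nx :=
  if k == k' then (if unlift ord_max k is Some t then l_xx t else phi_xx) else 0.

Definition K_x_u (k : 'I_N.+1) (t : 'I_N) : 'M[R]_(nx, nu) :=
  if k == now t then l_xu t else 0.

Definition K_u_u (t t' : 'I_N) : 'M[R]_nu := if t == t' then l_uu t else 0.

Definition diff_mpc_entry (p q : zvar N nx nu) : R :=
  match p, q with
  | Lam _ _, Lam _ _ => 0
  | Lam k i, Sta k' j => K_lam_x k k' i j
  | Sta k' j, Lam k i => K_lam_x k k' i j
  | Lam k i, Inp t j => K_lam_u k t i j
  | Inp t j, Lam k i => K_lam_u k t i j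
  | Sta k i, Sta k' j => K_x_x k k' i j
  | Sta k i, Inp t j => K_x_u k t i j
  | Inp t j, Sta k i => K_x_u k t i j
  | Inp t i, Inp t' j => K_u_u t t' i j
  end.

Definition diff_mpc_kkt : 'M[R]_#|{: zvar N nx nu}| := zmatrix diff_mpc_entry.

End Blocks.

End DiffMPC.

Arguments trajectory : clear implicits.
Arguments zspace : clear implicits.

(* Main.v *)
Require Import Defs.
From HB Require Import structures.
From mathcomp Require Import all_boot all_order all_algebra.
From mathcomp Require Import boolp classical_sets reals topology normedtype derive.
From mathcomp Require Import functions landau ring lra.
Import Order.TTheory GRing.Theory Num.Theory.
Import numFieldNormedType.Exports.
Local Open Scope classical_set_scope.
Local Open Scope ring_scope.

Set Implicit Arguments.
Unset Strict Implicit.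
Unset Printing Implicit Defensive.

(** Both systems have the same right-hand side, so everything reduces to an
    equality of matrices: the Hessian of the Lagrangian in [z] is the KKT matrix
    of Diff-MPC plus the curvature terms [lambda_{k+1} (x) f_ab^(k)].

    The Lagrangian is a sum of costs plus a sum of products
    [lambda_k * c_k] of a multiplier coordinate and the defect [c_k] of the
    k-th constraint ([lagrangianE]).  A multiplier coordinate is linear, so the
    second derivative of such a product in directions [v], [w] is
    [lambda_k(z) c_k''(v, w) + lambda_k(v) c_k'(w) + lambda_k(w) c_k'(v)].
    The first term is the curvature that Gauss-Newton drops; the two others are
    the Jacobian blocks [-I], [f_x], [f_u] of the KKT matrix and their
    transposes; the costs give the blocks [l_xx], [l_xu], [l_uu], [phi_xx].
    The rules of second-order calculus behind this are the closure properties
    of [has_hessian], and they produce one bilinear formula for the whole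
    Hessian ([has_hessian_lagrangian]).  Evaluating it on pairs of basis vectors
    yields the blocks ([hess_lagrangian_entry]).

    One block needs an actual theorem of analysis.  In row [u_k], column [x_k],
    the Hessian contains the derivative of [l] in [u] first and then in [x],
    whereas the KKT matrix, being symmetric, contains the transpose of [l_xu].
    These agree by Schwarz's theorem, in the form that requires the first
    derivatives to be differentiable at the single point considered
    ([deriveC]). *)

(** * Directional derivatives along affine maps *)

Section AffineSubstitution.
Context {R : realType} {U V W : normedModType R}.
Variables (g : V -> W) (phi : U -> V) (q v : U) (v' : V).
Hypothesis phi_affine : forall s : R, phi (s *: v + q) = s *: v' + phi q.

Let growth_rate_comp_affine :
  (fun s => s^-1 *: (((g \o phi) \o shift q) (s *: v) - (g \o phi) q)) =
  (fun s => s^-1 *: ((g \o shift (phi q)) (s *: v') - g (phi q))).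
Proof. by apply/funext => s /=; rewrite phi_affine. Qed.

(** Both sides are limits of the same difference quotient, so they agree even
    where the limit does not exist.  This lets partial derivatives in [x] or in
    [u] alone be read as directional derivatives in [(x, u)]. *)
Lemma derive_comp_affine : 'D_v (g \o phi) q = 'D_v' g (phi q).
Proof. by rewrite /derive growth_rate_comp_affine. Qed.

Lemma derivable_comp_affine :
  derivable g (phi q) v' -> derivable (g \o phi) q v.
Proof. by rewrite /derivable growth_rate_comp_affine. Qed.

Lemma is_derive_comp_affine (dg : W) :
  is_derive (phi q) v' g dg -> is_derive q v (g \o phi) dg.
Proof.
move=> [dv <-]; split; first exact: derivable_comp_affine.
exact: derive_comp_affine.
Qed.

End AffineSubstitution.

(** * Symmetry of second derivatives *)

Section SecondDifference.
Context {R : realType} {V : normedModType R}.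
Implicit Types (h : V -> R) (p v w : V) (s : R).

Definition second_difference h p v w s : R :=
  h (p + s *: v + s *: w) - h (p + s *: v) - (h (p + s *: w) - h p).

Lemma second_differenceC h p v w s :
  second_difference h p v w s = second_difference h p w v s.
Proof. by rewrite /second_difference [p + _ + _]addrAC; ring. Qed.

(** With [g r := h (p + r v + s w) - h (p + r v)] the second difference is
    [g s - g 0], hence [s * g' c] for some [c] in [[0, s]] by the mean value
    theorem.  Here [g' c] is a difference of two values of [k := 'D_v h] at
    points within O(s) of [p]; the first-order expansion of [k] at [p] turns it into
    [s * 'd k p w + o(s)], the contributions of [c v] cancelling. *)
Lemma second_difference_approx h p v w (e : R) :
  (\forall q \near p, differentiable h q) ->
  differentiable ('D_v h) p -> 0 < e ->
  \forall s \near 0^'+,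
    `|second_difference h p v w s - s ^+ 2 * 'D_w ('D_v h) p| <= e * s ^+ 2.
Proof.
move=> dh dk e0; set k := 'D_v h.
(* The two expansions have increments [c v + s w] and [c v], whose norms add
   up to at most [C * s]. *)
set C : R := 2 * (`|v| + `|w|) + 1.
have C0 : 0 < C.
  by rewrite /C; have := normr_ge0 v; have := normr_ge0 w; lra.
have eC0 : 0 < e / C by rewrite divr_gt0.
have /nbhs_ballP[d1 /= d10 hd1] := dh.
have : \forall y \near (0 : V), `|k (p + y) - k p - 'd k p y| <= e / C * `|y|.
  have /eqaddoP := diff_locally dk => /(_ _ eC0); apply: filterS => y /=.
  by rewrite -addrA -opprD [p + y]addrC.
move=> /nbhs_ballP[d2 /= d20 hd2].
have small d : 0 < d -> \forall s \near 0^'+, s * C < d.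
  move=> d0; near=> s; rewrite -ltr_pdivlMr//.
  by near: s; apply: nbhs_right_lt; rewrite divr_gt0.
near=> s.
have s0 : 0 < s by near: s; exact: nbhs_right_gt.
have sd1 : s * C < d1 by near: s; exact: small.
have sd2 : s * C < d2 by near: s; exact: small.
have nrm1 r : 0 <= r -> r <= s -> `|r *: v| <= s * `|v|.
  by move=> r0 rs; rewrite normrZ (ger0_norm r0) ler_wpM2r.
have nrm2 r : 0 <= r -> r <= s -> `|r *: v + s *: w| <= s * `|v| + s * `|w|.
  move=> r0 rs; rewrite (le_trans (ler_normD _ _))// lerD ?nrm1//.
  by rewrite normrZ gtr0_norm.
have sC : s * C = 2 * (s * `|v|) + 2 * (s * `|w|) + s by rewrite /C; ring.
have sv0 : 0 <= s * `|v| by rewrite mulr_ge0// ltW.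
have sw0 : 0 <= s * `|w| by rewrite mulr_ge0// ltW.
have near_p r : 0 <= r -> r <= s ->
    differentiable h (p + r *: v + s *: w) /\ differentiable h (p + r *: v).
  move=> r0 rs; split; apply: hd1; rewrite -ball_normE /=.
    rewrite -addrA opprD addrA subrr sub0r normrN.
    by have := nrm2 _ r0 rs; lra.
  by rewrite opprD addrA subrr sub0r normrN; have := nrm1 _ r0 rs; lra.
pose g r := h (p + r *: v + s *: w) - h (p + r *: v).
have dg r : 0 <= r -> r <= s ->
    is_derive r (1 : R) g (k (p + r *: v + s *: w) - k (p + r *: v)).
  move=> r0 rs; have [dh1 dh2] := near_p _ r0 rs.
  have scal1 t : t *: (1 : R) = t by exact: mulr1.
  apply: (@is_deriveB _ _ _ (h \o (fun r => p + r *: v + s *: w))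
                            (h \o (fun r => p + r *: v))).
    apply: (is_derive_comp_affine (v' := v)) => [t|].
      by rewrite scal1 scalerDl !addrA (addrC p).
    by apply: derivableP; exact: diff_derivable.
  apply: (is_derive_comp_affine (v' := v)) => [t|].
    by rewrite scal1 scalerDl !addrA (addrC p).
  by apply: derivableP; exact: diff_derivable.
have [c /[!in_itv]/= /andP[c0 cs] gE] : exists2 c, c \in `[0, s]%R &
   g s - g 0 = (k (p + c *: v + s *: w) - k (p + c *: v)) * (s - 0).
  apply: MVT_segment; first exact: ltW.
    by move=> x /[!in_itv]/= /andP[x0 xs]; apply: dg; exact: ltW.
  apply: derivable_within_continuous => x /[!in_itv]/= /andP[x0 xs].
  by have [] := dg _ x0 xs.
have -> : second_difference h p v w s = g s - g 0.
  by rewrite /second_difference /g !scale0r !addr0.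
rewrite gE subr0.
have -> : 'D_w k p = 'd k p w by rewrite deriveE.
have b1 : `|c *: v + s *: w| < d2 by have := nrm2 _ c0 cs; lra.
have b2 : `|c *: v| < d2 by have := nrm1 _ c0 cs; lra.
have := hd2 (c *: v + s *: w); have := hd2 (c *: v).
rewrite -!ball_normE /= !sub0r !normrN => /(_ b2) a2 /(_ b1) a1.
rewrite linearD !linearZ /= in a1; rewrite linearZ /= in a2.
rewrite addrA in a1.
set k1 := k _ in a1 *; set k2 := k (p + _) in a2 *.
set dv := 'd k p v in a1 a2; set dw := 'd k p w in a1 *.
rewrite -[c *: dv]/(c * dv) -[s *: dw]/(s * dw) in a1.
rewrite -[c *: dv]/(c * dv) in a2.
have -> : (k1 - k2) * s - s ^+ 2 * dw =
    s * ((k1 - k p - (c * dv + s * dw)) - (k2 - k p - c * dv)) by ring.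
rewrite normrM (gtr0_norm s0).
have -> : e * s ^+ 2 = s * (e / C * (s * C)) by field; rewrite gt_eqF.
rewrite ler_wpM2l ?(ltW s0)//.
rewrite (le_trans (ler_normB _ _))// (le_trans (lerD a1 a2))//.
rewrite -mulrDr ler_wpM2l ?(ltW eC0)//.
by have := nrm2 _ c0 cs; have := nrm1 _ c0 cs; lra.
Unshelve. all: by end_near. Qed.

(** Schwarz's theorem: the second difference is symmetric in [v] and [w], and
    divided by [s ^+ 2] it tends to either iterated derivative. *)
Lemma deriveC h p v w :
  (\forall q \near p, differentiable h q) ->
  differentiable ('D_v h) p -> differentiable ('D_w h) p ->
  'D_w ('D_v h) p = 'D_v ('D_w h) p.
Proof.
move=> dh dv dw; apply/eqP; rewrite -subr_eq0 -normr_le0.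
apply/ler_addgt0Pl => e e0; rewrite addr0.
have e20 : 0 < e / 2 by rewrite divr_gt0.
have app1 := second_difference_approx w dh dv e20.
have app2 := second_difference_approx v dh dw e20.
have [s [[s0 a1] a2]] := @filter_ex _ (0^'+) _ _
  (filterI (filterI (nbhs_right_gt (0 : R)) app1) app2).
rewrite second_differenceC in a1.
have s20 : 0 < s ^+ 2 by rewrite exprn_gt0.
rewrite -(ler_pM2l s20) -{1}(gtr0_norm s20) -normrM.
move: ('D_w _ _) ('D_v _ _) (second_difference _ _ _ _ _) a1 a2.
move=> A B F a1 a2.
have -> : s ^+ 2 * (A - B) = (F - s ^+ 2 * B) - (F - s ^+ 2 * A) by ring.
by apply: (le_trans (ler_normB _ _)); lra.
Qed.

End SecondDifference.

(** * Rules for second derivatives *)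

Section HessianCalculus.
Context {R : realType}.

(** Differentiability is required near [p] because the rules for sums and
    products rewrite ['D_v h] only where [h] is differentiable, and ['D_v h] is
    then differentiated at [p]. *)
Definition has_hessian (V : normedModType R) (h : V -> R) (p : V)
    (B : V -> V -> R) :=
  (\forall q \near p, differentiable h q) /\
  (forall v w, is_derive p w ('D_v h) (B v w)).

Context {V : normedModType R}.
Implicit Types (h g : V -> R) (p q v w : V).

Lemma has_hessian_derive h p B v w :
  has_hessian h p B -> 'D_w ('D_v h) p = B v w.
Proof. by case=> _ /(_ v w) [_ ->]. Qed.

Lemma has_hessian_eq h p B C :
  B =2 C -> has_hessian h p B -> has_hessian h p C.
Proof. by move=> BC [dh ddh]; split=> // v w; rewrite -BC. Qed.

Lemma twice_differentiable_hessian h p :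
  twice_differentiable h p ->
  has_hessian h p (fun v w => 'D_w ('D_v h) p).
Proof.
move=> [dh ddh]; split=> // v w.
by apply: derivableP; exact: diff_derivable.
Qed.

Lemma twice_differentiable_entry m n (h : V -> 'M[R]_(m, n)) p i j :
  twice_differentiable h p ->
  has_hessian (fun q => h q i j) p
    (fun v w => 'D_w ('D_v (fun q => h q i j)) p).
Proof.
move=> [dh ddh]; split.
  apply: filterS dh => q dq.
  apply: (differentiable_comp (g := fun M : 'M[R]_(m, n) => M i j : R) dq).
  exact: differentiable_coord.
move=> v w; apply: derivableP.
have : derivable (fun q => 'D_v h q i j) p w.
  by apply: (derivable_mxP _ _ _).1; exact: diff_derivable.
apply: near_eq_derivable; apply: filterS dh => q dq.
by rewrite derive_mx ?mxE//; exact: diff_derivable.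
Qed.

Lemma has_hessian_cst (c : R) p : has_hessian (fun=> c) p (fun _ _ => 0).
Proof.
split; first by apply: nearW => q; exact: differentiable_cst.
move=> v w; rewrite (_ : 'D_v _ = fun=> 0); first exact: is_derive_cst.
by apply/funext => q; rewrite derive_cst.
Qed.

Lemma has_hessianD h g p B C :
  has_hessian h p B -> has_hessian g p C ->
  has_hessian (fun q => h q + g q) p (fun v w => B v w + C v w).
Proof.
move=> [dh ddh] [dg ddg]; split.
  near=> q; apply: (@differentiableD _ _ _ h g).
    by near: q.
  by near: q.
move=> v w.
have dD := is_deriveD (ddh v w) (ddg v w).
apply: near_eq_is_derive dD; near=> q.
rewrite -[RHS]/('D_v (h + g) q) deriveD//.
  by apply: diff_derivable; near: q.
by apply: diff_derivable; near: q.
Unshelve. all: by end_near. Qed.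

Lemma has_hessian_sum (I : Type) (r : seq I) (h : I -> V -> R) p
    (B : I -> V -> V -> R) :
  (forall i, has_hessian (h i) p (B i)) ->
  has_hessian (fun q => \sum_(i <- r) h i q) p
              (fun v w => \sum_(i <- r) B i v w).
Proof.
move=> dh; elim: r => [|i r IHr].
  have -> : (fun q => \sum_(i <- [::]) h i q) = fun=> 0.
    by apply/funext => q; rewrite big_nil.
  have -> : (fun v w => \sum_(i <- [::]) B i v w) = fun _ _ => 0.
    by apply/funext => v; apply/funext => w; rewrite big_nil.
  exact: has_hessian_cst.
have -> : (fun q => \sum_(j <- i :: r) h j q) =
          (fun q => h i q + \sum_(j <- r) h j q).
  by apply/funext => q; rewrite big_cons.
have -> : (fun v w => \sum_(j <- i :: r) B j v w) =
          (fun v w => B i v w + \sum_(j <- r) B j v w).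
  by apply/funext => v; apply/funext => w; rewrite big_cons.
exact: has_hessianD.
Qed.

Lemma has_hessianM h g p B C :
  has_hessian h p B -> has_hessian g p C ->
  has_hessian (fun q => h q * g q) p
    (fun v w => h p * C v w + g p * B v w
                + ('D_v h p * 'D_w g p + 'D_w h p * 'D_v g p)).
Proof.
move=> [dh ddh] [dg ddg]; split.
  near=> q; apply: (@differentiableM _ _ h g).
    by near: q.
  by near: q.
move=> v w.
have dhp := nbhs_singleton dh; have dgp := nbhs_singleton dg.
have dh1 : is_derive p w h ('D_w h p).
  by apply: derivableP; exact: diff_derivable.
have dg1 : is_derive p w g ('D_w g p).
  by apply: derivableP; exact: diff_derivable.
have dM := is_deriveD (is_deriveM dh1 (ddg v w)) (is_deriveM dg1 (ddh v w)).
rewrite -![_ *: _]/(_ * _) in dM.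
have -> : h p * C v w + g p * B v w
    + ('D_v h p * 'D_w g p + 'D_w h p * 'D_v g p) =
  h p * C v w + 'D_v g p * 'D_w h p + (g p * B v w + 'D_v h p * 'D_w g p).
  by ring.
apply: near_eq_is_derive dM; near=> q.
rewrite -[RHS]/('D_v (h * g) q) deriveM//.
  by apply: diff_derivable; near: q.
by apply: diff_derivable; near: q.
Unshelve. all: by end_near. Qed.

Lemma derive_linear (W : normedModType R) (A : V -> W) q v :
  (forall s u x, A (s *: u + x) = s *: A u + A x) -> 'D_v A q = A v.
Proof.
move=> linA; rewrite -[A]/(id \o A).
rewrite (derive_comp_affine id (fun s => linA s v q)).
exact: derive_id.
Qed.

Lemma has_hessian_linear h p :
  (forall s u x, h (s *: u + x) = s * h u + h x) ->
  (forall q, differentiable h q) -> has_hessian h p (fun _ _ => 0).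
Proof.
move=> linh dh; split; first exact: nearW.
move=> v w; have -> : 'D_v h = fun=> h v.
  by apply/funext => q; rewrite derive_linear.
exact: is_derive_cst.
Qed.

(** A linear substitution contributes no second-order term of its own. *)
Lemma has_hessian_comp (U : normedModType R) (A : U -> V) h (x : U) B :
  (forall s u y, A (s *: u + y) = s *: A u + A y) ->
  (forall y, differentiable A y) ->
  has_hessian h (A x) B ->
  has_hessian (fun y => h (A y)) x (fun v w : U => B (A v) (A w)).
Proof.
move=> linA dA [dh ddh]; split.
  have cA : {for x, continuous A} by exact: differentiable_continuous.
  have dhA : \forall y \near x, differentiable h (A y) := cA _ dh.
  apply: filterS dhA => y dhy.
  exact: (differentiable_comp (dA y) dhy).
move=> v w; have -> : 'D_v (fun y => h (A y)) = 'D_(A v) h \o A.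
  by apply/funext => y; exact: derive_comp_affine (fun s => linA s v y).
have := is_derive_comp_affine (fun s => linA s w x) (ddh (A v) (A w)).
by [].
Qed.

End HessianCalculus.

(** * Coordinates of the primal-dual vector *)

Section Coordinates.
Context {R : realType} {nx nu N : nat}.
Local Notation Z := (zspace R nx nu N).
Implicit Types (q w : Z) (v : zvar N nx nu) (k : 'I_N.+1) (t : 'I_N).

Definition zbasis v : Z := delta_mx (enum_rank v) 0.

Lemma zcoord_basis v v' : zcoord (zbasis v) v' = (v' == v)%:R.
Proof. by rewrite /zcoord mxE eqxx andbT (inj_eq enum_rank_inj). Qed.

Lemma zcoord_linear v (s : R) w q :
  zcoord (s *: w + q) v = s * zcoord w v + zcoord q v.
Proof. by rewrite /zcoord !mxE. Qed.

Lemma differentiable_zcoord v q :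
  differentiable (fun q' : Z => zcoord q' v) q.
Proof. exact: differentiable_coord. Qed.

Lemma zmultE q k i : zmult q k i 0 = zcoord q (Lam k i).
Proof. by rewrite mxE. Qed.

Lemma zstateE q k i : zstate q k i 0 = zcoord q (Sta k i).
Proof. by rewrite !mxE. Qed.

Lemma zinputE q t i : zinput q t i 0 = zcoord q (Inp t i).
Proof. by rewrite !mxE. Qed.

Lemma zstate_linear k (s : R) w q :
  zstate (s *: w + q) k = s *: zstate w k + zstate q k.
Proof. by apply/colP => i; rewrite !mxE zcoord_linear. Qed.

Lemma zinput_linear t (s : R) w q :
  zinput (s *: w + q) t = s *: zinput w t + zinput q t.
Proof. by apply/colP => i; rewrite !mxE zcoord_linear. Qed.

Lemma differentiable_col_zcoord n (c : 'I_n -> zvar N nx nu) q :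
  differentiable (fun q' : Z => \col_i zcoord q' (c i) : 'cV[R]_n) q.
Proof.
have -> : (fun q' : Z => \col_i zcoord q' (c i) : 'cV[R]_n) =
    \sum_(i < n) (fun q' : Z => zcoord q' (c i) *: (delta_mx i 0 : 'cV[R]_n)).
  apply/funext => q'; rewrite fct_sumE; apply/colP => i; rewrite mxE summxE.
  rewrite (bigD1 i)//= big1 => [|j ji]; rewrite !mxE !eqxx ?mulr1 ?addr0//.
  by rewrite eq_sym (negbTE ji) mulr0.
by apply: differentiable_sum => i; apply: differentiableZl;
   exact: differentiable_zcoord.
Qed.

Lemma differentiable_zstate k q : differentiable (fun q' : Z => zstate q' k) q.
Proof.
have -> : (fun q' : Z => zstate q' k) = fun q' => \col_i zcoord q' (Sta k i).
  by apply/funext => q'; apply/colP => i; rewrite zstateE mxE.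
exact: differentiable_col_zcoord.
Qed.

Lemma differentiable_zinput t q : differentiable (fun q' : Z => zinput q' t) q.
Proof.
have -> : (fun q' : Z => zinput q' t) = fun q' => \col_i zcoord q' (Inp t i).
  by apply/funext => q'; apply/colP => i; rewrite zinputE mxE.
exact: differentiable_col_zcoord.
Qed.

Definition zstage t q : 'cV[R]_nx * 'cV[R]_nu := (zstate q (now t), zinput q t).

Lemma zstage_linear t (s : R) w q :
  zstage t (s *: w + q) = s *: zstage t w + zstage t q.
Proof. by rewrite /zstage zstate_linear zinput_linear. Qed.

Lemma differentiable_zstage t q : differentiable (zstage t) q.
Proof.
apply: differentiable_pair; first exact: differentiable_zstate.
exact: differentiable_zinput.
Qed.

Lemma zstate_basis_Lam k k' i : zstate (zbasis (Lam k i)) k' = 0.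
Proof. by apply/colP => j; rewrite zstateE zcoord_basis mxE; case: eqP. Qed.

Lemma zstate_basis_Inp t k' i : zstate (zbasis (Inp t i)) k' = 0.
Proof. by apply/colP => j; rewrite zstateE zcoord_basis mxE; case: eqP. Qed.

Lemma zstate_basis_Sta k k' i :
  zstate (zbasis (Sta k i)) k' = if k' == k then delta_mx i 0 else 0.
Proof.
apply/colP => j; rewrite zstateE zcoord_basis.
have -> : (Sta k' j == Sta k i :> zvar N nx nu) = (k' == k) && (j == i).
  by apply/eqP/andP => [[-> ->]//|[/eqP-> /eqP->]].
by case: eqP => _; rewrite !mxE ?eqxx ?andbT.
Qed.

Lemma zinput_basis_Lam k t i : zinput (zbasis (Lam k i)) t = 0.
Proof. by apply/colP => j; rewrite zinputE zcoord_basis mxE; case: eqP. Qed.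

Lemma zinput_basis_Sta k t i : zinput (zbasis (Sta k i)) t = 0.
Proof. by apply/colP => j; rewrite zinputE zcoord_basis mxE; case: eqP. Qed.

Lemma zinput_basis_Inp t t' i :
  zinput (zbasis (Inp t i)) t' = if t' == t then delta_mx i 0 else 0.
Proof.
apply/colP => j; rewrite zinputE zcoord_basis.
have -> : (Inp t' j == Inp t i :> zvar N nx nu) = (t' == t) && (j == i).
  by apply/eqP/andP => [[-> ->]//|[/eqP-> /eqP->]].
by case: eqP => _; rewrite !mxE ?eqxx ?andbT.
Qed.

End Coordinates.

(** * Blocks of second derivatives as iterated directional derivatives *)

Section PartialDerivatives.
Context {R : realType}.

Lemma derive2_0l (V : normedModType R) (h : V -> R) (p w : V) :
  'D_w ('D_0 h) p = 0.
Proof.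
have -> : 'D_0 h = fun=> 0 by apply/funext => q; rewrite derive0.
by rewrite derive_cst.
Qed.

Lemma derive_fst (V W : normedModType R) (h : V * W -> R) x u v :
  'D_v (fun y => h (y, u)) x = 'D_(v, 0) h (x, u).
Proof.
apply: (derive_comp_affine h (phi := fun y => (y, u))) => s.
by rewrite -[RHS]/(s *: v + x, s *: 0 + u) scaler0 add0r.
Qed.

Lemma derive_snd (V W : normedModType R) (h : V * W -> R) x u w :
  'D_w (fun y => h (x, y)) u = 'D_(0, w) h (x, u).
Proof.
apply: (derive_comp_affine h (phi := fun y => (x, y))) => s.
by rewrite -[RHS]/(s *: 0 + x, s *: w + u) scaler0 add0r.
Qed.

Context {n m : nat}.
Local Notation dx i := (delta_mx i 0 : 'cV[R]_n, 0 : 'cV[R]_m).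
Local Notation du j := (0 : 'cV[R]_n, delta_mx j 0 : 'cV[R]_m).
Variables (h : 'cV[R]_n -> 'cV[R]_m -> R) (x : 'cV[R]_n) (u : 'cV[R]_m).
Let H (w : 'cV[R]_n * 'cV[R]_m) := h w.1 w.2.

Lemma partial_fst i : partial (h^~ u) i x = 'D_(dx i) H (x, u).
Proof. exact: (derive_fst H). Qed.

Lemma partial_snd j : partial (h x) j u = 'D_(du j) H (x, u).
Proof. exact: (derive_snd H). Qed.

Lemma hess_fst i j : hess (h^~ u) x i j = 'D_(dx j) ('D_(dx i) H) (x, u).
Proof.
rewrite mxE -(derive_fst ('D_(dx i) H)).
have <- // : partial (h^~ u) i = fun y => 'D_(dx i) H (y, u).
by apply/funext => y; exact: (derive_fst H).
Qed.

Lemma hess_snd i j : hess (h x) u i j = 'D_(du j) ('D_(du i) H) (x, u).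
Proof.
rewrite mxE -(derive_snd ('D_(du i) H)).
have <- // : partial (h x) i = fun y => 'D_(du i) H (x, y).
by apply/funext => y; exact: (derive_snd H).
Qed.

Lemma mixed_hess_fst_snd i j :
  mixed_hess h x u i j = 'D_(du j) ('D_(dx i) H) (x, u).
Proof.
rewrite mxE -(derive_snd ('D_(dx i) H)).
have <- // : (fun y => partial (h^~ y) i x) = fun y => 'D_(dx i) H (x, y).
by apply/funext => y; exact: (derive_fst H).
Qed.

Lemma mixed_hess_snd_fst i j :
  mixed_hess (fun b a => h a b) u x i j = 'D_(dx j) ('D_(du i) H) (x, u).
Proof.
rewrite mxE -(derive_fst ('D_(du i) H)).
have <- // : (fun y => partial (h y) i u) = fun y => 'D_(du i) H (y, u).
by apply/funext => y; exact: (derive_snd H).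
Qed.

End PartialDerivatives.

(** * Basis directions seen from one stage *)

Section StageDirections.
Context {R : realType} {nx nu N : nat}.

Lemma zstage_basis_Lam t k i :
  zstage t (zbasis (Lam k i) : zspace R nx nu N) = 0.
Proof. by rewrite /zstage zstate_basis_Lam zinput_basis_Lam. Qed.

Lemma zstage_basis_Sta t k i :
  zstage t (zbasis (Sta k i) : zspace R nx nu N) =
  if now t == k then (delta_mx i 0, 0) else 0.
Proof. by rewrite /zstage zstate_basis_Sta zinput_basis_Sta; case: ifP. Qed.

Lemma zstage_basis_Inp t t' i :
  zstage t (zbasis (Inp t' i) : zspace R nx nu N) =
  if t == t' then (0, delta_mx i 0) else 0.
Proof. by rewrite /zstage zstate_basis_Inp zinput_basis_Inp; case: ifP. Qed.

Lemma sum_mult_basis (p : zvar N nx nu) (G : 'I_N.+1 -> 'I_nx -> R) :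
  \sum_k \sum_i zcoord (zbasis p : zspace R nx nu N) (Lam k i) * G k i =
  if p is Lam k i then G k i else 0.
Proof.
case: p => [k i|k i|t i].
- rewrite (bigD1 k)//= (bigD1 i)//= zcoord_basis eqxx mul1r.
  rewrite big1 => [|j ji]; last first.
    rewrite zcoord_basis.
    by case: eqP => [[/eqP]|_]; rewrite ?(negbTE ji) ?mul0r.
  rewrite big1 ?addr0// => k' kk'; rewrite big1// => j _.
  rewrite zcoord_basis.
  by case: eqP => [[/eqP]|_]; rewrite ?(negbTE kk') ?mul0r.
- by rewrite big1// => k' _; rewrite big1// => j _;
     rewrite zcoord_basis; case: eqP => // _; rewrite mul0r.
- by rewrite big1// => k' _; rewrite big1// => j _;
     rewrite zcoord_basis; case: eqP => // _; rewrite mul0r.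
Qed.

Lemma now_max (t : 'I_N) : (now t == ord_max) = false.
Proof. by apply/negbTE; rewrite eq_sym neq_lift. Qed.

Lemma now_eq (t t' : 'I_N) : (now t == now t') = (t == t').
Proof. exact: (inj_eq lift_inj). Qed.

Lemma next_eq (t t' : 'I_N) : (Defs.next t == Defs.next t') = (t == t').
Proof. exact: (inj_eq lift_inj). Qed.

Lemma next_now (t : 'I_N) : (Defs.next t == now t) = false.
Proof.
by rewrite -val_eqE [val (Defs.next t)]lift0 [val (now t)]lift_max gtn_eqF.
Qed.

End StageDirections.

(** * The Hessian of the Lagrangian *)

Section Lagrangian.
Context {R : realType} {nx nu nt N : nat}.
Variables (P : ocp R nx nu nt) (th : 'cV[R]_nt) (z : zspace R nx nu N).
Implicit Types (q v w : zspace R nx nu N) (k : 'I_N.+1) (t : 'I_N).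

Definition stage_cost (a : 'cV[R]_nx * 'cV[R]_nu) : R :=
  running_cost P a.1 a.2 th.

Definition stage_dynamics (i : 'I_nx) (a : 'cV[R]_nx * 'cV[R]_nu) : R :=
  dynamics P a.1 a.2 th i 0.

(** The initial condition is the constraint at time 0 and the dynamics of stage
    [t] is the one at time [t + 1]; treating them uniformly pairs each
    constraint with the multiplier of the same time. *)
Definition constraint k i q : R :=
  (if unlift ord0 k is Some t then stage_dynamics i (zstage t q)
   else initial_state P th i 0) - zcoord q (Sta k i).

Lemma lagrangianE q : lagrangian P th q =
  \sum_t stage_cost (zstage t q)
  + \sum_k \sum_i zcoord q (Lam k i) * constraint k i q
  + terminal_cost P (zstate q ord_max) th.
Proof.
rewrite /lagrangian big_split /= -!addrA; congr (_ + _).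
rewrite big_ord_recl /= addrA; congr (_ + _); rewrite [RHS]addrC.
congr (_ + _).
  apply: eq_bigr => t _; rewrite /dot mxE; apply: eq_bigr => i _.
  rewrite 2!mxE /constraint liftK; congr (_ * _).
  by rewrite mxE [X in _ + X]mxE zstateE.
rewrite /dot mxE; apply: eq_bigr => i _.
rewrite 2!mxE /constraint unlift_none; congr (_ * _).
by rewrite mxE [X in _ + X]mxE zstateE.
Qed.

Definition constraint_derivative k i v : R :=
  (if unlift ord0 k is Some t
   then 'D_(zstage t v) (stage_dynamics i) (zstage t z) else 0)
  - zcoord v (Sta k i).

(** The second derivative of the stage Lagrangian [l + lambda_{t+1}^T f] in the
    directions [v], [w], with [lambda_{t+1}] held constant. *)
Definition stage_curvature t (v w : 'cV[R]_nx * 'cV[R]_nu) : R :=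
  'D_w ('D_v stage_cost) (zstage t z)
  + \sum_i zcoord z (Lam (Defs.next t) i)
      * 'D_w ('D_v (stage_dynamics i)) (zstage t z).

Definition terminal_curvature (v w : 'cV[R]_nx) : R :=
  'D_w ('D_v (fun x => terminal_cost P x th)) (zstate z ord_max).

Hypothesis f_diff2 : forall t, twice_differentiable
  (fun a : 'cV[R]_nx * 'cV[R]_nu => dynamics P a.1 a.2 th) (zstage t z).
Hypothesis l_diff2 : forall t, twice_differentiable
  (fun a : 'cV[R]_nx * 'cV[R]_nu => running_cost P a.1 a.2 th) (zstage t z).
Hypothesis phi_diff2 : twice_differentiable
  (fun x : 'cV[R]_nx => terminal_cost P x th) (zstate z ord_max).

Lemma has_hessian_zcoord p : has_hessian (fun q => zcoord q p) z (fun _ _ => 0).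
Proof.
apply: has_hessian_linear; first by move=> s u x; exact: zcoord_linear.
by move=> q; exact: differentiable_zcoord.
Qed.

Lemma has_hessian_stage (h : 'cV[R]_nx * 'cV[R]_nu -> R) t B :
  has_hessian h (zstage t z) B ->
  has_hessian (fun q => h (zstage t q)) z
              (fun v w => B (zstage t v) (zstage t w)).
Proof.
apply: has_hessian_comp; first by move=> *; exact: zstage_linear.
by move=> q; exact: differentiable_zstage.
Qed.

Lemma has_hessian_constraint k i :
  has_hessian (constraint k i) z
    (fun v w => if unlift ord0 k is Some t then
      'D_(zstage t w) ('D_(zstage t v) (stage_dynamics i)) (zstage t z) else 0).
Proof.
have dyn : has_hessian (fun q => if unlift ord0 k is Some t
    then stage_dynamics i (zstage t q) else initial_state P th i 0) z
    (fun v w => if unlift ord0 k is Some t then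
      'D_(zstage t w) ('D_(zstage t v) (stage_dynamics i)) (zstage t z) else 0).
  case: unliftP => [t _|_]; last exact: has_hessian_cst.
  exact: has_hessian_stage (twice_differentiable_entry i 0 (f_diff2 t)).
have state : has_hessian (fun q => - zcoord q (Sta k i)) z (fun _ _ => 0).
  apply: has_hessian_linear => [s u x|q].
    by rewrite zcoord_linear opprD mulrN.
  by apply: differentiableN; exact: differentiable_zcoord.
by apply: has_hessian_eq (has_hessianD dyn state) => v w; rewrite addr0.
Qed.

Lemma derive_constraint k i v :
  'D_v (constraint k i) z = constraint_derivative k i v.
Proof.
have dzc : is_derive z v (fun q => zcoord q (Sta k i)) (zcoord v (Sta k i)).
  split; first exact/diff_derivable/differentiable_zcoord.
  by apply: derive_linear => *; exact: zcoord_linear.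
apply: derive_val; apply: is_deriveB; case: unliftP => [t _|_]; last first.
  exact: is_derive_cst.
have := is_derive_comp_affine (fun s => zstage_linear t s v z).
apply; apply: derivableP; apply: diff_derivable.
by have [/nbhs_singleton] :=
  twice_differentiable_entry i 0 (f_diff2 t).
Qed.

(** The last two sums come from differentiating each product
    [lambda_k * c_k] once in each factor; they are exchanged by swapping [v] and
    [w], which is why the KKT matrix carries each Jacobian block twice. *)
Lemma has_hessian_lagrangian :
  has_hessian (lagrangian P th) z (fun v w =>
    \sum_t stage_curvature t (zstage t v) (zstage t w)
    + terminal_curvature (zstate v ord_max) (zstate w ord_max)
    + (\sum_k \sum_i zcoord v (Lam k i) * constraint_derivative k i w
       + \sum_k \sum_i zcoord w (Lam k i) * constraint_derivative k i v)).
Proof.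
have -> : lagrangian P th = fun q => \sum_t stage_cost (zstage t q)
  + \sum_k \sum_i zcoord q (Lam k i) * constraint k i q
  + terminal_cost P (zstate q ord_max) th.
  by apply/funext => q; exact: lagrangianE.
apply: (has_hessian_eq _ (has_hessianD (has_hessianD
  (has_hessian_sum (index_enum _) (fun t => has_hessian_stage
     (twice_differentiable_hessian (l_diff2 t))))
  (has_hessian_sum (index_enum _) (fun k =>
     has_hessian_sum (index_enum _) (fun i =>
       has_hessianM (has_hessian_zcoord (Lam k i))
                    (has_hessian_constraint k i)))))
  (has_hessian_comp (zstate_linear ord_max) (differentiable_zstate ord_max)
     (twice_differentiable_hessian phi_diff2)))) => v w.
have -> : \sum_t stage_curvature t (zstage t v) (zstage t w) =
    \sum_t 'D_(zstage t w) ('D_(zstage t v) stage_cost) (zstage t z)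
    + \sum_k \sum_i zcoord z (Lam k i) * (if unlift ord0 k is Some t then
      'D_(zstage t w) ('D_(zstage t v) (stage_dynamics i)) (zstage t z) else 0).
  rewrite big_split /= [in RHS]big_ord_recl unlift_none.
  rewrite [X in _ + (X + _)]big1 ?add0r => [|i _]; last by rewrite mulr0.
  by congr (_ + _); apply: eq_bigr => t _; rewrite liftK.
rewrite [RHS]addrAC; congr (_ + _); rewrite -addrA; congr (_ + _).
rewrite -!big_split /=.
apply: eq_bigr => k _; rewrite -!big_split /=; apply: eq_bigr => i _.
have dzc u : 'D_u (fun q => zcoord q (Lam k i)) z = zcoord u (Lam k i).
  by apply: derive_linear => *; exact: zcoord_linear.
by rewrite !dzc !derive_constraint mulr0 addr0.
Qed.

Lemma hess_lagrangian p p' :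
  hess (lagrangian P th) z (enum_rank p) (enum_rank p') =
    \sum_t stage_curvature t (zstage t (zbasis p)) (zstage t (zbasis p'))
    + terminal_curvature (zstate (zbasis p) ord_max)
                         (zstate (zbasis p') ord_max)
    + ((if p is Lam k i then constraint_derivative k i (zbasis p') else 0)
       + (if p' is Lam k i then constraint_derivative k i (zbasis p) else 0)).
Proof.
have hessE := has_hessian_derive (zbasis p) (zbasis p') has_hessian_lagrangian.
by rewrite mxE [LHS]hessE !sum_mult_basis.
Qed.

Local Notation dx i := (delta_mx i 0 : 'cV[R]_nx, 0 : 'cV[R]_nu).
Local Notation du j := (0 : 'cV[R]_nx, delta_mx j 0 : 'cV[R]_nu).

Lemma f_xE t i j : f_x P th z t i j = 'D_(dx j) (stage_dynamics i) (zstage t z).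
Proof. by rewrite mxE (partial_fst (fun x u => dynamics P x u th i 0)). Qed.

Lemma f_uE t i j : f_u P th z t i j = 'D_(du j) (stage_dynamics i) (zstage t z).
Proof. by rewrite mxE (partial_snd (fun x u => dynamics P x u th i 0)). Qed.

Lemma stage_curvature_xx t i j :
  stage_curvature t (dx i) (dx j) = l_xx P th z t i j + lam_f_xx P th z t i j.
Proof.
rewrite /l_xx (hess_fst (fun x u => running_cost P x u th)); congr (_ + _).
rewrite summxE; apply: eq_bigr => m _.
by rewrite mxE zmultE (hess_fst (fun x u => dynamics P x u th m 0)).
Qed.

Lemma stage_curvature_xu t i j :
  stage_curvature t (dx i) (du j) = l_xu P th z t i j + lam_f_xu P th z t i j.
Proof.
rewrite /l_xu (mixed_hess_fst_snd (fun x u => running_cost P x u th)).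
congr (_ + _).
rewrite summxE; apply: eq_bigr => m _.
by rewrite mxE zmultE (mixed_hess_fst_snd (fun x u => dynamics P x u th m 0)).
Qed.

(** Unlike in the other three blocks, the order of differentiation of [l] is not
    the one of the KKT matrix, which has the transpose of [l_xu] here; the term
    in [f] keeps its order, as in [lam_f_ux]. *)
Lemma stage_curvature_ux t i j :
  stage_curvature t (du i) (dx j) = l_xu P th z t j i + lam_f_ux P th z t i j.
Proof.
rewrite /l_xu (mixed_hess_fst_snd (fun x u => running_cost P x u th)).
have [dl ddl] := l_diff2 t.
rewrite /stage_curvature.
rewrite (deriveC (h := stage_cost) dl (ddl (du i)) (ddl (dx j))).
congr (_ + _).
rewrite summxE; apply: eq_bigr => m _.
by rewrite mxE zmultE (mixed_hess_snd_fst (fun x u => dynamics P x u th m 0)).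
Qed.

Lemma stage_curvature_uu t i j :
  stage_curvature t (du i) (du j) = l_uu P th z t i j + lam_f_uu P th z t i j.
Proof.
rewrite /l_uu (hess_snd (fun x u => running_cost P x u th)); congr (_ + _).
rewrite summxE; apply: eq_bigr => m _.
by rewrite mxE zmultE (hess_snd (fun x u => dynamics P x u th m 0)).
Qed.

Lemma stage_curvature0l t b : stage_curvature t 0 b = 0.
Proof.
rewrite /stage_curvature derive2_0l add0r big1// => i _.
by rewrite derive2_0l mulr0.
Qed.

Lemma stage_curvature0r t a : stage_curvature t a 0 = 0.
Proof.
rewrite /stage_curvature derive0 add0r big1// => i _.
by rewrite derive0 mulr0.
Qed.

Lemma terminal_curvature0l b : terminal_curvature 0 b = 0.
Proof. exact: derive2_0l. Qed.

Lemma terminal_curvature0r a : terminal_curvature a 0 = 0.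
Proof. exact: derive0. Qed.

Lemma terminal_curvature_xx i j :
  terminal_curvature (delta_mx i 0) (delta_mx j 0) = phi_xx P th z i j.
Proof. by rewrite mxE. Qed.

Lemma constraint_derivative_Lam k i k' j :
  constraint_derivative k i (zbasis (Lam k' j)) = 0.
Proof.
rewrite /constraint_derivative zcoord_basis.
case: eqP => // _; rewrite subr0; case: unlift => // t.
by rewrite zstage_basis_Lam derive0.
Qed.

Lemma constraint_derivative_Sta k i k' j :
  constraint_derivative k i (zbasis (Sta k' j)) = K_lam_x P th z k k' i j.
Proof.
rewrite /constraint_derivative /K_lam_x zcoord_basis.
have -> : (Sta k i == Sta k' j :> zvar N nx nu) = (k == k') && (i == j).
  by apply/eqP/andP => [[-> ->]//|[/eqP-> /eqP->]].
case: eqP => [<-|_] /=.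
  rewrite !mxE; case: unliftP => [t ->|_]; last by rewrite sub0r.
  by rewrite zstage_basis_Sta eq_sym next_now derive0 sub0r.
rewrite subr0; case: unliftP => [t _|_]; last by rewrite mxE.
rewrite zstage_basis_Sta eq_sym; case: ifP => _; last by rewrite derive0 mxE.
by rewrite f_xE.
Qed.

Lemma constraint_derivative_Inp k i t j :
  constraint_derivative k i (zbasis (Inp t j)) = K_lam_u P th z k t i j.
Proof.
rewrite /constraint_derivative /K_lam_u zcoord_basis.
case: eqP => // _; rewrite subr0.
case: unliftP => [t' ->|->]; last by rewrite (negbTE (neq_lift _ _)) mxE.
rewrite zstage_basis_Inp next_eq.
case: eqP => [->|_]; last by rewrite derive0 mxE.
by rewrite f_uE.
Qed.

Lemma sum_single (G : 'I_N -> R) t :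
  (forall t', t' != t -> G t' = 0) -> \sum_t G t = G t.
Proof.
by move=> G0; rewrite (bigD1 t)//= big1 ?addr0// => t' ?; exact: G0.
Qed.

(** A basis direction in [lambda] is invisible to the curvature terms, and one
    in [x] or [u] to the multiplier coordinates.  A direction in [x_k] or [u_k]
    is seen by the curvature of stage [k] only, or of the terminal cost when
    [k = N], so at most one curvature term survives in each block. *)
Lemma hess_lagrangian_entry p p' :
  hess (lagrangian P th) z (enum_rank p) (enum_rank p') =
  diff_mpc_entry P th z p p' + curvature_entry P th z p p'.
Proof.
rewrite hess_lagrangian.
case: p p' => [k i|k i|t i] [k' j|k' j|t' j] /=.
- rewrite !constraint_derivative_Lam zstate_basis_Lam terminal_curvature0l.
  by rewrite big1 ?addr0// => t _; rewrite zstage_basis_Lam stage_curvature0l.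
- rewrite constraint_derivative_Sta zstate_basis_Lam terminal_curvature0l.
  rewrite big1 ?addr0 ?add0r// => t _.
  by rewrite zstage_basis_Lam stage_curvature0l.
- rewrite constraint_derivative_Inp zstate_basis_Lam terminal_curvature0l.
  rewrite big1 ?addr0 ?add0r// => t _.
  by rewrite zstage_basis_Lam stage_curvature0l.
- rewrite constraint_derivative_Sta zstate_basis_Lam terminal_curvature0r.
  rewrite big1 ?addr0 ?add0r// => t _.
  by rewrite zstage_basis_Lam stage_curvature0r.
- rewrite !addr0 !zstate_basis_Sta /K_x_x.
  case: (eqVneq k k') => [<-|kk']; last first.
    rewrite mxE addr0 big1 ?add0r => [|t _].
      case: (ord_max =P k) => [kE|_]; last by rewrite terminal_curvature0l.
      case: (ord_max =P k') => [k'E|_]; last by rewrite terminal_curvature0r.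
      by rewrite -kE -k'E eqxx in kk'.
    rewrite !zstage_basis_Sta.
    case: (now t =P k) => [kE|_]; last by rewrite stage_curvature0l.
    case: (now t =P k') => [k'E|_]; last by rewrite stage_curvature0r.
    by rewrite -kE -k'E eqxx in kk'.
  case: unliftP => [t ->|->].
    rewrite [ord_max == _]eq_sym now_max terminal_curvature0l addr0.
    rewrite (sum_single (t := t)) => [|t' tt'].
      by rewrite !zstage_basis_Sta eqxx stage_curvature_xx.
    by rewrite zstage_basis_Sta now_eq (negbTE tt') stage_curvature0l.
  rewrite eqxx terminal_curvature_xx addr0 big1 ?add0r// => t _.
  by rewrite zstage_basis_Sta now_max stage_curvature0l.
- rewrite !addr0 zstate_basis_Inp terminal_curvature0r addr0 /K_x_u.
  rewrite (sum_single (t := t')) => [|t tt']; last first.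
    by rewrite zstage_basis_Inp (negbTE tt') stage_curvature0r.
  rewrite zstage_basis_Sta zstage_basis_Inp eqxx eq_sym.
  case: eqP => _; first exact: stage_curvature_xu.
  by rewrite stage_curvature0l mxE addr0.
- rewrite constraint_derivative_Inp zstate_basis_Lam terminal_curvature0r.
  rewrite big1 ?addr0 ?add0r// => t' _.
  by rewrite zstage_basis_Lam stage_curvature0r.
- rewrite !addr0 zstate_basis_Inp terminal_curvature0l addr0 /K_x_u.
  rewrite (sum_single (t := t)) => [|t' tt']; last first.
    by rewrite zstage_basis_Inp (negbTE tt') stage_curvature0l.
  rewrite zstage_basis_Sta zstage_basis_Inp eqxx eq_sym.
  case: eqP => _; first exact: stage_curvature_ux.
  by rewrite stage_curvature0r mxE addr0.
- rewrite !addr0 zstate_basis_Inp terminal_curvature0l addr0 /K_u_u.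
  rewrite (sum_single (t := t)) => [|s st]; last first.
    by rewrite zstage_basis_Inp (negbTE st) stage_curvature0l.
  rewrite !zstage_basis_Inp eqxx.
  case: eqP => _; first exact: stage_curvature_uu.
  by rewrite stage_curvature0r mxE addr0.
Qed.

End Lagrangian.

(** * Equality of the two linear systems *)

Theorem corollary6 (R : realType) (nx nu nt N : nat) (P : ocp R nx nu nt)
  (loss : 'M[R]_(nx, N.+1) * 'M[R]_(nu, N) -> R)
  (th : 'cV[R]_nt) (z : zspace R nx nu N)
  (xi_diff : forall th', differentiable (initial_state P) th')
  (f_diff2 : forall t : 'I_N,
     twice_differentiable
       (fun w : 'cV[R]_nx * 'cV[R]_nu => dynamics P w.1 w.2 th)
       (zstate z (now t), zinput z t))
  (l_diff2 : forall t : 'I_N,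
     twice_differentiable
       (fun w : 'cV[R]_nx * 'cV[R]_nu => running_cost P w.1 w.2 th)
       (zstate z (now t), zinput z t))
  (phi_diff2 :
     twice_differentiable (fun x : 'cV[R]_nx => terminal_cost P x th)
       (zstate z ord_max))
  (loss_diff : forall tau, differentiable loss tau)
  (z_opt : optimal P th (ztraj z))
  (z_kkt : grad (lagrangian P th) z = 0) :
  diff_mpc_kkt P th z = gauss_newton_hessian P th z /\
  forall dz : zspace R nx nu N,
    diff_mpc_kkt P th z *m dz = - grad (fun z' => loss (ztraj z')) z <->
    gauss_newton_hessian P th z *m dz = - grad (fun z' => loss (ztraj z')) z.
Proof.
suff -> : diff_mpc_kkt P th z = gauss_newton_hessian P th z by split.
apply/matrixP => i j.
have := hess_lagrangian_entry f_diff2 l_diff2 phi_diff2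
  (enum_val i) (enum_val j).
rewrite !enum_valK => hessE.
rewrite mxE [RHS]mxE hessE [X in _ = _ + X]mxE [X in _ = _ - X]mxE.
by rewrite addrK.
Qed.
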